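(* Let $H=(V,E)$ be a connected finite hypergraph with vertex measure $\mu$ and hyperedge weight $\omega$, and let $\Omega$ be a non-empty finite subset of $V$ such that $\Omega^c=V\setminus\Omega$ is non-empty. Let $\alpha\in\mathbb{R}$ and $$\lambda_1(\Omega)=\inf_{\phi\not\equiv0,\ \phi|_{\partial\Omega}=0}\frac{\int_{\Omega\cup\partial\Omega}|\nabla\phi|^2\,d\mu}{\int_\Omega\phi^2\,d\mu}.$$ If $\alpha<\lambda_1(\Omega)$, then for any $p>2$ the equation $$\begin{cases}-\Delta\phi-\alpha\phi=|\phi|^{p-2}\phi & \text{in }\Omega,\\ \phi=0 & \text{on }\partial\Omega\end{cases}$$ admits a nontrivial solution.
   Context: A (finite, undirected) hypergraph $H=(V,E)$ consists of a finite vertex set $V$ and a set $E$ of hyperedges, each hyperedge $e\in E$ being a subset of $V$ with cardinality $\delta_e:=|e|$ satisfying $2\le\delta_e\le|V|$. $H$ is connected if for any two different vertices $v,v'$ there is a sequence of hyperedges $e_1,\dots,e_l\in E$ with $v\in e_1$, $v'\in e_l$ and $e_n\cap e_{n+1}\ne\emptyset$ for $1\le n\le l-1$. The measure is a function $\mu:V\to(0,\infty)$ and the weight is a function $\omega:E\to(0,\infty)$, written $\omega_e=\omega(e)$. For $A\subset V$, $\int_A g\,d\mu=\sum_{v\in A}\mu(v)g(v)$. For $\phi:V\to\mathbb{R}$ and $v\in V$, $$|\nabla\phi|^2(v)=\sum_{e\in E:\,v\in e}\frac{\omega_e}{\mu(v)\delta_e(\delta_e-1)}\Big[\sum_{u\in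 e}(\phi(u)-\phi(v))\Big]^2,$$ and the Laplace operator (divergence of the hypergraph gradient) is given explicitly by $$\Delta\phi(v)=\frac{1}{\mu(v)}\sum_{e\in E:\,v\in e}\frac{\omega_e}{\delta_e-1}\sum_{u\in e:\,u\ne v}(\phi(u)-\phi(v)).$$ The boundary of $\Omega$ is $\partial\Omega=\{u\in V\setminus\Omega:\ \exists\, v\in\Omega,\ \exists\, e\in E\text{ with }u,v\in e\}$. Convention: functions vanishing on $\partial\Omega$ are understood to vanish on all of $\Omega^c$ (extension by zero); in particular the infimum defining $\lambda_1(\Omega)$ is over functions $\phi\not\equiv0$ vanishing on $\Omega^c$. A nontrivial solution is a function $\phi:V\to\mathbb{R}$, not identically zero, with $\phi=0$ on $\Omega^c$, satisfying $-\Delta\phi(v)-\alpha\phi(v)=|\phi(v)|^{p-2}\phi(v)$ for every $v\in\Omega$. *)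

(* Defs.v *)
From HB Require Import structures.
From mathcomp Require Import all_boot all_order all_algebra.
From mathcomp Require Import boolp classical_sets reals exp.

Set Implicit Arguments.
Unset Strict Implicit.
Unset Printing Implicit Defensive.

Import Order.TTheory GRing.Theory Num.Theory.

Local Open Scope ring_scope.

(* The bound #|e| <= #|V| holds for every e : {set V}. *)
Record hypergraph (V : finType) := Hypergraph {
  hyperedges : {set {set V}};
  hyperedge_card : forall e, e \in hyperedges -> (2 <= #|e|)%N
}.

(* The sequence e_1, ..., e_l is e1 :: s. *)
Definition hconnected (V : finType) (H : hypergraph V) : Prop :=
  forall v v' : V, v != v' ->
    exists (e1 : {set V}) (s : seq {set V}),
      [/\ {subset e1 :: s <= hyperedges H},
          v \in e1, v' \in last e1 s &
          path (fun e e' : {set V} => e :&: e' != finset.set0) e1 s].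

Definition boundary (V : finType) (H : hypergraph V) (Omega : {set V}) :
    {set V} :=
  [set u | (u \notin Omega) &&
    [exists v in Omega, exists e in hyperedges H, (u \in e) && (v \in e)]].

Section Operators.
Variables (R : realType) (V : finType) (H : hypergraph V).
(* Only the values of the weight omega on hyperedges H are used. *)
Variables (mu : V -> R) (omega : {set V} -> R).

Definition vertex_integral (A : {set V}) (g : V -> R) : R :=
  \sum_(v in A) mu v * g v.

Definition gradient_sq (phi : V -> R) (v : V) : R :=
  \sum_(e in hyperedges H | v \in e)
    omega e / (mu v * #|e|%:R * (#|e|%:R - 1))
    * (\sum_(u in e) (phi u - phi v)) ^+ 2.

Definition laplacian (phi : V -> R) (v : V) : R :=
  (mu v)^-1 * \sum_(e in hyperedges H | v \in e)
    omega e / (#|e|%:R - 1) * \sum_(u in e | u != v) (phi u - phi v).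

(* The Dirichlet condition is imposed on the whole complement of Omega
   (extension by zero), not only on the boundary. *)
Definition dirichlet (Omega : {set V}) (phi : V -> R) : Prop :=
  forall v, v \notin Omega -> phi v = 0.

Definition nontrivial (phi : V -> R) : Prop := exists v, phi v != 0.

Definition lambda1 (Omega : {set V}) : R :=
  inf [set q : R | exists phi : V -> R,
    [/\ nontrivial phi, dirichlet Omega phi &
        q = vertex_integral (Omega :|: boundary H Omega) (gradient_sq phi)
            / vertex_integral Omega (fun v => phi v ^+ 2)]]%classic.

End Operators.

(* Main.v *)
From mathcomp Require Import boolp classical_sets topology normedtype derive.
Require Import Defs.
From HB Require Import structures.
From mathcomp Require Import all_boot all_order all_algebra.
From mathcomp Require Import reals exp.
From mathcomp Require Import ring lra.

Set Implicit Arguments.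
Unset Strict Implicit.
Unset Printing Implicit Defensive.

Import Order.TTheory GRing.Theory Num.Theory.
Import numFieldNormedType.Exports.

Local Open Scope ring_scope.

(** The equation is the Euler-Lagrange equation of a quotient of two
    functionals of finitely many real variables, and the solution is a rescaled
    minimiser of that quotient.

    On functions supported in Omega, the operator - Delta - alpha multiplied by
    mu is given by a symmetric matrix A.  Exchanging the sums over vertices
    and hyperedges gives both Green's formula and the identity
    int |grad phi|^2 dmu = - int phi Delta phi dmu (lemmas [green] and
    [sum_gradient_sq]: both sides are the same sum over hyperedges), so that
    x A x^T is the Dirichlet energy minus alpha times the mass.  The definition
    of lambda_1 as an infimum then says that A is positive definite as soon as
    alpha < lambda_1 ([shifted_laplacian_posdef]).

    The rest is a statement on positive definite matrices
    ([posdef_power_equation]): x A = mu |x|^(p-2) x has a nonzero solution.  The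
    sphere N(x) = sum_i mu_i |x_i|^p = 1 is compact, hence x A x^T attains on it
    a minimum m > 0, at some x0.  Differentiating the constraint is avoided as
    follows.  Let L(y) = sum_i mu_i |x0_i|^(p-2) x0_i y_i.  Young's inequality
    gives |L| <= 1 on the sphere, so by homogeneity y A y^T >= m L(y)^2 for
    every y, with equality at y = x0.  The quadratic form y A y^T - m L(y)^2 is
    thus nonnegative and vanishes at x0; hence x0 lies in its kernel, that is
    x0 A = m L(x0) L = m mu |x0|^(p-2) x0.  As p differs from 2, the factor m is
    absorbed by replacing x0 with m^(1/(p-2)) x0. *)

(** * Powers of absolute values *)

Section PowerTerms.
Variable R : realType.
Implicit Types (x y p : R).

Lemma continuous_powR_norm p : 1 <= p -> continuous (fun x : R => `|x| `^ p).
Proof.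
move=> p1 x; have p0 : 0 < p by lra.
have [->|xN0] := eqVneq x 0.
  (* At 0 the argument by differentiability breaks down; there |z|^p <= |z| for
     |z| <= 1, because p >= 1. *)
  rewrite /continuous_at normr0 powR0 ?gt_eqF//.
  apply/cvgr0Pnorm_lt => e e0; near=> z.
  have z1 : `|z| < Num.min e 1.
    by near: z; apply: (@nbhs0_lt _ R^o); rewrite lt_min e0 ltr01.
  move: z1; rewrite lt_min => /andP[ze z1].
  rewrite ger0_norm ?powR_ge0//; apply: le_lt_trans ze.
  have [->|zN0] := eqVneq z 0; first by rewrite normr0 powR0// gt_eqF.
  by apply: ge1r_powR => //; rewrite normr_gt0 zN0 ltW.
apply: (@continuous_comp _ _ _ (fun z : R => `|z|) (fun z : R => z `^ p)).
  exact: norm_continuous.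
apply: differentiable_continuous; apply/derivable1_diffP.
by apply: derivable_powR; rewrite in_itv/= andbT normr_gt0.
Unshelve. all: by end_near. Qed.

Lemma powR_norm_sqr p x : 2 < p -> `|x| `^ (p - 2) * x * x = `|x| `^ p.
Proof.
move=> p2; rewrite -mulrA -expr2 -real_normK ?num_real// -powR_mulrn//.
by rewrite -powRD ?subrK// (gt_eqF (lt_trans _ p2)).
Qed.

(** Young's inequality with the conjugate exponents p / (p - 1) and p, applied
    to |x|^(p-1) and |y|. *)
Lemma young_powR_norm p x y : 2 < p ->
  `|x| `^ (p - 2) * x * y <= (1 - p^-1) * `|x| `^ p + p^-1 * `|y| `^ p.
Proof.
move=> p2; apply: le_trans (ler_norm _) _.
rewrite !normrM (ger0_norm (powR_ge0 _ _)).
have -> : `|x| `^ (p - 2) * `|x| = `|x| `^ (p - 1).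
  have -> : p - 2 = p - 1 - 1 by ring.
  by rewrite mulrC mulr_powRB1//; lra.
have p1 : p - 1 != 0 by rewrite gt_eqF//; lra.
have pN0 : p != 0 by rewrite gt_eqF//; lra.
have := @conjugate_powR R (`|x| `^ (p - 1)) `|y| (p / (p - 1)) p.
move=> /(_ (powR_ge0 _ _) (normr_ge0 _)) H.
apply: le_trans (H _ _ _) _.
- by apply: divr_gt0; lra.
- by lra.
- by field; rewrite p1 pN0.
rewrite -powRrM.
have -> : (p - 1) * (p / (p - 1)) = p by field.
rewrite le_eqVlt; apply/orP; left; apply/eqP; field.
by rewrite p1 pN0.
Qed.

(** A nonnegative quadratic polynomial in t that vanishes at t = 0 has a minimum
    there.  The test value t = - b / (c + 1) replaces the usual vertex - b / c
    so as to cover c = 0. *)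
Lemma quadratic_ge0_linear_eq0 (b c : R) :
  (forall t, 0 <= 2 * b * t + c * t ^+ 2) -> b = 0.
Proof.
move=> H; have c0 : 0 <= c.
  by have := H 1; have := H (-1); rewrite sqrrN !expr1n; lra.
have c1 : c + 1 != 0 by rewrite gt_eqF//; lra.
have := H (- b / (c + 1)).
have -> : 2 * b * (- b / (c + 1)) + c * (- b / (c + 1)) ^+ 2
  = - ((b / (c + 1)) ^+ 2 * (c + 2)) by field.
rewrite oppr_ge0 pmulr_lle0; last by lra.
move=> h; have : (b / (c + 1)) ^+ 2 == 0 by rewrite eq_le h sqr_ge0.
by rewrite sqrf_eq0 mulf_eq0 invr_eq0 (negbTE c1) orbF => /eqP.
Qed.

End PowerTerms.

(** * Positive definite matrices and the power nonlinearity *)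

Lemma continuous_sum (R : realType) (T : topologicalType) (n : nat)
    (f : 'I_n -> T -> R) :
  (forall i, continuous (f i)) -> continuous (fun x => \sum_i f i x).
Proof.
move=> cf.
exact: (@continuous_big R 'I_n (@GRing.add R) 0 xpredT
  (@add_continuous R) T _ f (fun i _ => cf i)).
Qed.

Section PositiveDefinite.
Variables (R : realType) (n : nat).
Implicit Types (A : 'M[R]_n) (x y z : 'rV[R]_n) (mu : 'I_n -> R) (p : R).

Definition bilin A x y : R := (x *m A *m y^T) 0 0.

Lemma bilinE A x y : bilin A x y = \sum_i (x *m A) 0 i * y 0 i.
Proof. by rewrite /bilin mxE; apply: eq_bigr => i _; rewrite [y^T _ _]mxE. Qed.

Lemma bilinC A x y : A^T = A -> bilin A x y = bilin A y x.
Proof.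
move=> As; rewrite /bilin -[in RHS](trmxK (y *m A *m x^T)) [RHS]mxE.
by rewrite !trmx_mul trmxK As mulmxA.
Qed.

Lemma bilinDl A x x' y : bilin A (x + x') y = bilin A x y + bilin A x' y.
Proof. by rewrite /bilin !mulmxDl mxE. Qed.

Lemma bilinZl A a x y : bilin A (a *: x) y = a * bilin A x y.
Proof. by rewrite /bilin -!scalemxAl mxE. Qed.

Lemma bilinZr A a x y : bilin A x (a *: y) = a * bilin A x y.
Proof. by rewrite /bilin linearZ -scalemxAr mxE. Qed.

Lemma bilin_line A x y t : A^T = A ->
  bilin A (x + t *: y) (x + t *: y)
    = bilin A x x + 2 * bilin A x y * t + bilin A y y * t ^+ 2.
Proof.
move=> As; rewrite bilinDl bilinZl ![bilin A _ (x + _)]bilinC//.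
rewrite !bilinDl !bilinZl [bilin A y x]bilinC//; ring.
Qed.

Lemma continuous_bilin A : continuous (fun x => bilin A x x).
Proof.
have -> : (fun x => bilin A x x) =
    (fun x => \sum_i (\sum_j x 0 j * A j i) * x 0 i).
  by apply/funext => x; rewrite bilinE; apply: eq_bigr => i _; rewrite mxE.
apply: continuous_sum => i x.
apply: continuousM; last exact: coord_continuous.
apply: continuous_sum => {x} j x.
apply: continuousM; [exact: coord_continuous|exact: cst_continuous].
Qed.

Definition power_sum mu p x : R := \sum_i mu i * `|x 0 i| `^ p.

(** As a function of y, this is the derivative at x of power_sum mu p / p. *)
Definition power_form mu p x y : R :=
  \sum_i mu i * (`|x 0 i| `^ (p - 2) * x 0 i) * y 0 i.

Lemma continuous_power_sum mu p : 1 <= p -> continuous (power_sum mu p).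
Proof.
move=> p1; apply: continuous_sum => i x.
apply: (@continuousM _ _ (fun=> mu i) (fun z : 'rV[R]_n => `|z 0 i| `^ p)).
  exact: cst_continuous.
apply: (@continuous_comp _ _ _ (fun z : 'rV[R]_n => z 0 i)
  (fun z : R => `|z| `^ p)).
  exact: coord_continuous.
exact: continuous_powR_norm.
Qed.

Lemma power_sumZ mu p a x :
  power_sum mu p (a *: x) = `|a| `^ p * power_sum mu p x.
Proof.
rewrite /power_sum mulr_sumr; apply: eq_bigr => i _.
by rewrite mxE normrM powRM// mulrCA.
Qed.

Lemma power_form_diag mu p x : 2 < p -> power_form mu p x x = power_sum mu p x.
Proof.
by move=> p2; apply: eq_bigr => i _; rewrite -mulrA powR_norm_sqr.
Qed.

Lemma power_formZr mu p x a y :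
  power_form mu p x (a *: y) = a * power_form mu p x y.
Proof.
by rewrite /power_form mulr_sumr; apply: eq_bigr => i _; rewrite mxE mulrCA.
Qed.

Lemma power_formDr mu p x y z :
  power_form mu p x (y + z) = power_form mu p x y + power_form mu p x z.
Proof.
by rewrite /power_form -big_split; apply: eq_bigr => i _; rewrite mxE mulrDr.
Qed.

Lemma power_sum_gt0 mu p x : (forall i, 0 < mu i) -> x != 0 ->
  0 < power_sum mu p x.
Proof.
move=> mu0 x0; have /rV0Pn[i xi0] := x0.
rewrite /power_sum (bigD1 i)//= ltr_pwDl//.
  by rewrite mulr_gt0// powR_gt0// normr_gt0.
by apply: sumr_ge0 => j _; rewrite mulr_ge0// ?powR_ge0// ltW.
Qed.

Lemma young_power_form mu p x y : (forall i, 0 < mu i) -> 2 < p ->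
  power_form mu p x y <=
  (1 - p^-1) * power_sum mu p x + p^-1 * power_sum mu p y.
Proof.
move=> mu0 p2; rewrite /power_form /power_sum !mulr_sumr -big_split/=.
apply: ler_sum => i _; rewrite -mulrA.
have -> : (1 - p^-1) * (mu i * `|x 0 i| `^ p) + p^-1 * (mu i * `|y 0 i| `^ p)
  = mu i * ((1 - p^-1) * `|x 0 i| `^ p + p^-1 * `|y 0 i| `^ p) by ring.
by rewrite ler_pM2l// young_powR_norm.
Qed.

(** The case of Hoelder's inequality where both vectors have weighted p-norm 1:
    Young's inequality for y and - y bounds the form by (1 - 1/p) + 1/p. *)
Lemma power_form_sphere_le1 mu p x y : (forall i, 0 < mu i) -> 2 < p ->
  power_sum mu p x = 1 -> power_sum mu p y = 1 -> power_form mu p x y ^+ 2 <= 1.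
Proof.
move=> mu0 p2 x1 y1.
have yN1 : power_sum mu p (- y) = 1.
  by rewrite -scaleN1r power_sumZ normrN1 powR1 mul1r.
have := young_power_form x y mu0 p2.
have := young_power_form x (- y) mu0 p2.
rewrite -scaleN1r power_formZr scaleN1r x1 y1 yN1 => h1 h2.
by rewrite -real_normK ?num_real// expr_le1// ler_norml; lra.
Qed.

Lemma power_sphere_normalize mu p y : (forall i, 0 < mu i) -> 2 < p -> y != 0 ->
  exists2 r, 0 < r & exists2 z, y = r *: z & power_sum mu p z = 1.
Proof.
move=> mu0 p2 y0; have s0 := power_sum_gt0 p mu0 y0.
pose r := power_sum mu p y `^ p^-1; have r0 : 0 < r by rewrite powR_gt0.
have rp : r `^ p = power_sum mu p y.
  by rewrite -powRrM mulVf ?powRr1 ?ltW// gt_eqF//; lra.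
exists r => //; exists (r^-1 *: y).
  by rewrite scalerA divff ?scale1r// gt_eqF.
rewrite power_sumZ -rp gtr0_norm ?invr_gt0// -powRM ?invr_ge0 ?ltW//.
by rewrite mulVf ?powR1// gt_eqF.
Qed.

(** On the sphere each coordinate satisfies mu_i |x_i|^p <= 1, which confines it
    to a box. *)
Lemma compact_power_sphere mu p : (forall i, 0 < mu i) -> 2 < p ->
  compact [set x : 'rV[R]_n | power_sum mu p x = 1]%classic.
Proof.
move=> mu0 p2.
pose b i := (mu i)^-1 `^ p^-1.
apply: (@subclosed_compact _ _
  [set x : 'rV[R]_n | forall i, `[- b i, b i]%classic (x ord0 i)]%classic).
- apply: (@preimage_closed _ _ (power_sum mu p) [set x | x = 1]%classic).
    by move=> x _; apply: continuous_power_sum; lra.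
  exact: closed_eq.
- apply: (@rV_compact R n (fun i => `[- b i, b i]%classic)) => i.
  exact: segment_compact.
- move=> x /= x1 i; rewrite /= in_itv/= -ler_norml.
  have : mu i * `|x 0 i| `^ p <= 1.
    rewrite -x1 /power_sum (bigD1 i)//= lerDl.
    by apply: sumr_ge0 => j _; rewrite mulr_ge0// ?powR_ge0// ltW.
  rewrite -ler_pdivlMl// mulr1 => h.
  have -> : `|x ord0 i| = (`|x 0 i| `^ p) `^ p^-1.
    by rewrite -powRrM divff ?powRr1//; lra.
  by apply: ge0_ler_powR; rewrite ?nnegrE ?powR_ge0// ?invr_ge0 ?ltW//; lra.
Qed.

(** The minimiser x0 of x A x^T on the sphere power_sum mu p x = 1 solves the
    equation up to the factor m, the minimum; no derivative is taken, because x0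
    also minimises the difference of y A y^T and m times a squared linear
    form. *)
Lemma posdef_power_equation A mu p :
  (0 < n)%N -> A^T = A -> (forall x : 'rV_n, x != 0 -> 0 < bilin A x x) ->
  (forall i, 0 < mu i) -> 2 < p ->
  exists2 x : 'rV_n, x != 0 &
    forall i, (x *m A) 0 i = mu i * (`|x 0 i| `^ (p - 2) * x 0 i).
Proof.
move=> n0 As Apos mu0 p2.
have [x0 x0S x0min] : exists2 x0, power_sum mu p x0 = 1 &
    forall y, power_sum mu p y = 1 -> bilin A x0 x0 <= bilin A y y.
  have [|||c cS cmin] := @EVT_min_rV R n (fun x => bilin A x x)
    [set x : 'rV[R]_n | power_sum mu p x = 1]%classic.
  - have e0 : (const_mx 1 : 'rV[R]_n) != 0.
      apply/eqP => /rowP /(_ (Ordinal n0)); rewrite !mxE => /eqP.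
      by rewrite oner_eq0.
    by have [_ _ [z _ z1]] := power_sphere_normalize mu0 p2 e0; exists z.
  - exact: compact_power_sphere.
  - exact/continuous_subspaceT/continuous_bilin.
  - exists c; first exact: (set_mem cS).
    by move=> y y1; apply: cmin; exact: mem_set.
have x0N0 : x0 != 0.
  apply: contra_eq_neq x0S => ->.
  by rewrite /power_sum big1 1?eq_sym ?oner_eq0// => i _;
     rewrite mxE normr0 powR0 ?mulr0// gt_eqF//; lra.
pose m := bilin A x0 x0; have m0 : 0 < m by apply: Apos.
(* Normalise y to the sphere, where the left-hand form is at most m. *)
have min_form_ge y : m * power_form mu p x0 y ^+ 2 <= bilin A y y.
  have [->|yN0] := eqVneq y 0.
    by rewrite -(scale0r (0 : 'rV_n)) power_formZr bilinZl !mul0r expr0n mulr0.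
  have [r r0 [z -> z1]] := power_sphere_normalize mu0 p2 yN0.
  rewrite power_formZr bilinZl bilinZr exprMn mulrCA [leRHS]mulrA -expr2.
  rewrite ler_pM2l ?exprn_gt0//.
  apply: le_trans (x0min _ z1); rewrite -[leRHS]mulr1 ler_pM2l//.
  exact: power_form_sphere_le1.
have x0x0 : power_form mu p x0 x0 = 1 by rewrite power_form_diag.
have EL y : bilin A x0 y = m * power_form mu p x0 y.
  apply/eqP; rewrite -subr_eq0; apply/eqP.
  apply: (@quadratic_ge0_linear_eq0 _ _
    (bilin A y y - m * power_form mu p x0 y ^+ 2)) => t.
  have := min_form_ge (x0 + t *: y).
  rewrite bilin_line// power_formDr power_formZr x0x0 -/m -subr_ge0.
  by congr (0 <= _); ring.
have x0E i : (x0 *m A) 0 i = m * (mu i * (`|x0 0 i| `^ (p - 2) * x0 0 i)).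
  have sum_delta (F : 'I_n -> R) : \sum_j F j * delta_mx 0 i (0 : 'I_1) j = F i.
    rewrite (bigD1 i)//= big1 => [|j /negbTE ji].
      by rewrite mxE !eqxx mulr1 addr0.
    by rewrite mxE ji andbF mulr0.
  by have := EL (delta_mx 0 i); rewrite bilinE /power_form !sum_delta.
(* Scaling by t multiplies the left side by t and the right side by
   t ^ (p - 1), so t ^ (p - 2) = m removes the factor m. *)
pose t := m `^ (p - 2)^-1.
have t0 : 0 < t by rewrite powR_gt0.
have tp : t `^ (p - 2) = m.
  by rewrite /t -powRrM mulVf ?powRr1 ?ltW// gt_eqF//; lra.
exists (t *: x0); first by rewrite scaler_eq0 gt_eqF.
move=> i; rewrite -scalemxAl [LHS]mxE x0E [(t *: x0) _ _]mxE.
rewrite normrM (gtr0_norm t0).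
rewrite (powRM _ (ltW t0) (normr_ge0 _)) tp.
ring.
Qed.

End PositiveDefinite.

(** * Dirichlet energy of a hypergraph *)

Section HypergraphEnergy.
Variables (R : realType) (V : finType) (H : hypergraph V).
Variables (mu : V -> R) (omega : {set V} -> R).
Hypothesis mu_gt0 : forall v, 0 < mu v.
Hypothesis omega_gt0 : forall e, e \in hyperedges H -> 0 < omega e.
Implicit Types (phi h : V -> R) (e Omega : {set V}).

(** The polarised Dirichlet energy.  On one hyperedge with d vertices,
    d * sum phi h - (sum phi) (sum h) is half the sum over ordered pairs (u, v) of
    (phi u - phi v) (h u - h v). *)
Definition edge_form phi h : R :=
  \sum_(e in hyperedges H) omega e / (#|e|%:R - 1) *
    (#|e|%:R * (\sum_(v in e) phi v * h v)
      - (\sum_(v in e) phi v) * (\sum_(v in e) h v)).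

Lemma edge_formC phi h : edge_form phi h = edge_form h phi.
Proof.
apply: eq_bigr => e _; rewrite [in X in _ * (_ - X)]mulrC.
by under eq_bigr do rewrite mulrC.
Qed.

Lemma sum_edge_diff phi e v :
  \sum_(u in e) (phi u - phi v) = \sum_(u in e) phi u - #|e|%:R * phi v.
Proof. by rewrite sumrB sumr_const mulr_natl. Qed.

Lemma edge_card_gt1 e : e \in hyperedges H -> 2 <= #|e|%:R :> R.
Proof. by move=> /hyperedge_card; rewrite ler_nat. Qed.

Lemma sum_vertex_edge (F : V -> {set V} -> R) :
  \sum_v \sum_(e in hyperedges H | v \in e) F v e =
  \sum_(e in hyperedges H) \sum_(v in e) F v e.
Proof.
rewrite (exchange_big_dep (mem (hyperedges H)))/= => [|v e _ /andP[]//].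
by apply: eq_bigr => e eH; apply: eq_bigl => v; rewrite eH.
Qed.

(** Green's formula, by exchanging the sums over vertices and hyperedges.  The
    term u = v being zero, the sum over u in a hyperedge of d vertices is
    S - d phi v, where S is the sum of phi over the hyperedge. *)
Lemma green phi h :
  \sum_v mu v * laplacian H mu omega phi v * h v = - edge_form phi h.
Proof.
have mu_neq0 v : mu v != 0 by rewrite gt_eqF.
under eq_bigr => v _ do
  rewrite /laplacian mulrA divff// mul1r mulr_suml.
rewrite sum_vertex_edge -sumrN; apply: eq_bigr => e eH.
have -> : \sum_(v in e)
    omega e / (#|e|%:R - 1) * (\sum_(u in e | u != v) (phi u - phi v)) * h v
  = \sum_(v in e) omega e / (#|e|%:R - 1) *
      ((\sum_(u in e) phi u) * h v - #|e|%:R * (phi v * h v)).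
  apply: eq_bigr => v ve; rewrite -mulrA; congr (_ * _).
  rewrite [#|e|%:R * _]mulrA -mulrBl -sum_edge_diff (bigD1 v ve)/=.
  by rewrite subrr add0r.
set S := \sum_(v in e) phi v.
by rewrite -mulr_sumr sumrB -!mulr_sumr -[RHS]mulrN opprB.
Qed.

(** With S and Q the sums of phi and phi^2 over a hyperedge of d vertices,
    expanding the squares gives sum_v (S - d phi v)^2 = d (d Q - S^2): the
    gradient, although its square is taken after summing over u, has the same
    energy as the Laplacian. *)
Lemma sum_gradient_sq phi :
  \sum_v mu v * gradient_sq H mu omega phi v = edge_form phi phi.
Proof.
under eq_bigr do rewrite mulr_sumr.
rewrite sum_vertex_edge; apply: eq_bigr => e eH.
have d2 := edge_card_gt1 eH.
have d0 : #|e|%:R != 0 :> R by rewrite gt_eqF//; lra.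
have d1 : #|e|%:R - 1 != 0 :> R by rewrite gt_eqF//; lra.
set d : R := #|e|%:R in d2 d0 d1 *.
set S := \sum_(v in e) phi v.
have -> : \sum_(v in e) mu v * (omega e / (mu v * d * (d - 1)) *
      (\sum_(u in e) (phi u - phi v)) ^+ 2) =
    \sum_(v in e) omega e / (d * (d - 1)) *
      (S ^+ 2 - 2 * d * S * phi v + d ^+ 2 * (phi v * phi v)).
  apply: eq_bigr => v _; rewrite sum_edge_diff -/d -/S; field.
  by rewrite d1 d0 gt_eqF.
rewrite -mulr_sumr big_split/= sumrB sumr_const -mulr_sumr -/S -mulr_sumr.
rewrite -[_ *+ _]mulr_natl -/d; field.
by rewrite d1 d0.
Qed.

Lemma gradient_sq_ge0 phi v : 0 <= gradient_sq H mu omega phi v.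
Proof.
apply: sumr_ge0 => e /andP[eH _]; have d2 := edge_card_gt1 eH.
rewrite mulr_ge0 ?sqr_ge0// divr_ge0 ?ltW ?omega_gt0//.
by rewrite !mulr_gt0//; lra.
Qed.

(** A hyperedge that contains a vertex outside Omega and its boundary does not
    meet Omega, so phi vanishes on it. *)
Lemma gradient_sq_out Omega phi v : dirichlet Omega phi ->
  v \notin Omega :|: boundary H Omega -> gradient_sq H mu omega phi v = 0.
Proof.
move=> phi0; rewrite !inE negb_or => /andP[vO]; rewrite vO/= => vB.
apply: big1 => e /andP[eH ve]; rewrite big1 ?expr0n ?mulr0// => u ue.
rewrite !phi0 ?subrr//; apply: contra vB => uO.
by apply/existsP; exists u; rewrite uO; apply/existsP; exists e; rewrite eH ve.
Qed.

Lemma dirichlet_energy Omega phi : dirichlet Omega phi ->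
  vertex_integral mu (Omega :|: boundary H Omega) (gradient_sq H mu omega phi)
    = edge_form phi phi.
Proof.
move=> phi0; rewrite -sum_gradient_sq.
rewrite [RHS](bigID (mem (Omega :|: boundary H Omega)))/=.
rewrite [X in _ + X]big1 ?addr0// => v vO.
by rewrite (gradient_sq_out phi0)// mulr0.
Qed.

Lemma mass_gt0 Omega phi : nontrivial phi -> dirichlet Omega phi ->
  0 < vertex_integral mu Omega (fun v => phi v ^+ 2).
Proof.
move=> [v pv] phi0; have vO : v \in Omega by apply: contraR pv => /phi0 ->.
rewrite /vertex_integral (bigD1 v vO)/= ltr_pwDl//.
  by rewrite mulr_gt0// exprn_even_gt0.
by apply: sumr_ge0 => u _; rewrite mulr_ge0 ?sqr_ge0 ?ltW.
Qed.

(** The infimum bounds every Rayleigh quotient from below because the set of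
    quotients has 0 as a lower bound: weights and measure are positive. *)
Lemma lambda1_le_rayleigh Omega phi : nontrivial phi -> dirichlet Omega phi ->
  lambda1 H mu omega Omega * vertex_integral mu Omega (fun v => phi v ^+ 2)
    <= edge_form phi phi.
Proof.
move=> phiN0 phi0; rewrite -ler_pdivlMr ?mass_gt0//.
apply: ge_inf; last by exists phi; rewrite dirichlet_energy.
exists 0 => _ [psi [psiN0 psi0 ->]].
apply: divr_ge0; last by rewrite ltW// mass_gt0.
by apply: sumr_ge0 => v _; rewrite mulr_ge0 ?gradient_sq_ge0// ltW.
Qed.

(** The factor mu v makes the operator symmetric for the unweighted sum over
    vertices. *)
Definition shifted_laplacian alpha phi v : R :=
  mu v * (- laplacian H mu omega phi v - alpha * phi v).

Lemma shifted_laplacian_form alpha phi h :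
  \sum_v shifted_laplacian alpha phi v * h v
    = edge_form phi h - alpha * \sum_v mu v * (phi v * h v).
Proof.
rewrite -[edge_form _ _]opprK -green mulr_sumr -sumrN -sumrB.
by apply: eq_bigr => v _; rewrite /shifted_laplacian; ring.
Qed.

Lemma shifted_laplacian_sym alpha phi h :
  \sum_v shifted_laplacian alpha phi v * h v
    = \sum_v shifted_laplacian alpha h v * phi v.
Proof.
rewrite !shifted_laplacian_form edge_formC; congr (_ - _ * _).
by apply: eq_bigr => v _; rewrite [phi v * _]mulrC.
Qed.

Lemma shifted_laplacian_posdef alpha Omega phi :
  alpha < lambda1 H mu omega Omega -> nontrivial phi -> dirichlet Omega phi ->
  0 < \sum_v shifted_laplacian alpha phi v * phi v.
Proof.
move=> al phiN0 phi0; rewrite shifted_laplacian_form subr_gt0.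
apply: lt_le_trans (lambda1_le_rayleigh phiN0 phi0).
have -> : \sum_v mu v * (phi v * phi v) =
    vertex_integral mu Omega (fun v => phi v ^+ 2).
  rewrite (bigID (mem Omega))/= [X in _ + X]big1 ?addr0//.
  by move=> v vO; rewrite phi0// mulr0 mulr0.
by rewrite ltr_pM2r ?mass_gt0.
Qed.

End HypergraphEnergy.

(** * The nonlinear equation *)

Theorem theorem4p2 (R : realType) (V : finType) (H : hypergraph V)
    (mu : V -> R) (omega : {set V} -> R) (Omega : {set V}) (alpha : R)
    (Hconn : hconnected H)
    (mu_gt0 : forall v, 0 < mu v)
    (omega_gt0 : forall e, e \in hyperedges H -> 0 < omega e)
    (Omega_neq0 : Omega != set0)
    (OmegaC_neq0 : ~: Omega != set0)
    (alpha_lt : alpha < lambda1 H mu omega Omega)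
    (p : R) (p_gt2 : 2 < p) :
  exists phi : V -> R,
    [/\ nontrivial phi,
        dirichlet Omega phi &
        forall v, v \in Omega ->
          - laplacian H mu omega phi v - alpha * phi v
            = (`|phi v| `^ (p - 2)) * phi v].
Proof.
have /set0Pn[v0 v0O] := Omega_neq0.
(* Functions supported in Omega are row vectors indexed by an enumeration w of
   Omega; ext extends such a vector by 0. *)
pose S := shifted_laplacian H mu omega alpha.
pose ind (v u : V) : R := (u == v)%:R.
pose w (i : 'I_#|Omega|) : V := enum_val i.
pose ext (x : 'rV[R]_#|Omega|) v :=
  if v \in Omega then x 0 (enum_rank_in v0O v) else 0.
have extw x i : ext x (w i) = x 0 i.
  by rewrite /ext /w enum_valP enum_valK_in.
have ext0 x : dirichlet Omega (ext x) by move=> v /negbTE vO; rewrite /ext vO.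
have sum_ext (x : 'rV_#|Omega|) (F : V -> R) :
    \sum_i F (w i) * x 0 i = \sum_v F v * ext x v.
  rewrite [RHS](bigID (mem Omega))/= [X in _ + X]big1 ?addr0; last first.
    by move=> v vO; rewrite ext0// mulr0.
  under eq_bigr do rewrite -extw.
  by rewrite -(big_enum_val (fun v => F v * ext x v)).
have sum_ind v (F : V -> R) : \sum_u F u * ind v u = F v.
  rewrite (bigD1 v)//= big1 => [|u /negbTE uv].
    by rewrite /ind eqxx mulr1 addr0.
  by rewrite /ind uv mulr0.
(* Column j of A is the operator applied to the indicator of w j.  By symmetry
   of the operator, multiplying a row vector by A amounts to applying the
   operator to its extension by 0. *)
pose A : 'M[R]_#|Omega| := \matrix_(i, j) S (ind (w j)) (w i).
have AE (x : 'rV_#|Omega|) j : (x *m A) 0 j = S (ext x) (w j).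
  rewrite mxE; under eq_bigr do rewrite mxE mulrC.
  by rewrite (sum_ext x (S (ind (w j)))) /S shifted_laplacian_sym//.
have As : A^T = A.
  apply/matrixP => i j; rewrite !mxE -(sum_ind (w j) (S _)) /S.
  by rewrite shifted_laplacian_sym// sum_ind.
have Apos (x : 'rV_#|Omega|) : x != 0 -> 0 < bilin A x x.
  move=> /rV0Pn[i xi]; rewrite bilinE; under eq_bigr do rewrite AE.
  rewrite (sum_ext x (S (ext x))).
  apply: shifted_laplacian_posdef alpha_lt _ (ext0 x) => //.
  by exists (w i); rewrite extw.
have Omega_gt0 : (0 < #|Omega|)%N by rewrite card_gt0.
have [x xN0 xE] :=
  posdef_power_equation Omega_gt0 As Apos (fun i => mu_gt0 (w i)) p_gt2.
exists (ext x); split=> //.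
  by have /rV0Pn[i xi] := xN0; exists (w i); rewrite extw.
move=> v vO; have <- : w (enum_rank_in v0O v) = v by exact: enum_rankK_in.
move: (enum_rank_in v0O v) => i; rewrite extw.
apply: (mulfI (lt0r_neq0 (mu_gt0 (w i)))).
by rewrite -xE AE /S /shifted_laplacian extw.
Qed.
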